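(* Every plane Laman graph admits an extended weak labeling.
   Context: A Laman graph is a graph with $n$ vertices and $2n-3$ edges such that every induced subgraph on $k\ge 2$ vertices has at most $2k-3$ edges; a plane Laman graph is a Laman graph with a fixed planar embedding. An angle is an incidence of a vertex with a face. An extended weak labeling of a plane Laman graph $G$ is a map from its angles to $\{0,1\}$ such that: (G$0'$) there are two adjacent special vertices $s_0,s_1$ such that all angles at $s_i$ are labeled $i$; (G1) for each vertex $v\notin\{s_0,s_1\}$ the labels around $v$ form one non-empty cyclic interval of $1$s and one non-empty cyclic interval of $0$s; (G$2'$) for each edge other than $s_0s_1$, the two labels on the two sides of the edge coincide at one endpoint and differ at the other; (G3) for each face (including the outer face), its labels, read cyclically, form one non-empty interval of $1$s and one non-empty interval of $0$s. *)

(* Defs.v *)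
(* Plane graphs are encoded combinatorially by rotation systems. *)
From HB Require Import structures.
From mathcomp Require Import all_boot fingroup perm.
Set Implicit Arguments. Unset Strict Implicit. Unset Printing Implicit Defensive.

Section Defs.
Variable V : finType.

Definition simple_graph (e : rel V) := symmetric e /\ irreflexive e.

Definition edges (e : rel V) : {set {set V}} :=
  [set [set p.1; p.2] | p : V * V & e p.1 p.2].

Definition induced_edges (e : rel V) (S : {set V}) : {set {set V}} :=
  [set [set p.1; p.2] | p : V * V & [&& p.1 \in S, p.2 \in S & e p.1 p.2]].

(* Laman: n vertices, 2n-3 edges (stated as |E| + 3 = 2n, which forces n >= 2),
   every induced subgraph on k >= 2 vertices has at most 2k-3 edges *)
Definition laman (e : rel V) :=
  #|edges e| + 3 = 2 * #|V| /\
  forall S : {set V}, 2 <= #|S| -> #|induced_edges e S| + 3 <= 2 * #|S|.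

Definition dart (e : rel V) := {p : V * V | e p.1 p.2}.
Definition tail (e : rel V) (d : dart e) : V := (val d).1.
Definition head (e : rel V) (d : dart e) : V := (val d).2.
(* reversal of a dart (well defined for a symmetric relation) *)
Definition rev_dart (e : rel V) (d : dart e) : dart e :=
  insubd d ((val d).2, (val d).1).

Definition rotation_system (e : rel V) (sigma : {perm dart e}) :=
  (forall d, tail (sigma d) = tail d) /\
  (forall d d', tail d = tail d' -> fconnect sigma d d').

(* face permutation: after traversing d, continue with the dart following
   (rev d) in the rotation at the head of d *)
Definition face_succ (e : rel V) (sigma : {perm dart e}) (d : dart e) : dart e :=
  sigma (rev_dart d).

(* a planar (spherical) embedding of a connected graph: a rotation system
   of genus 0, i.e. satisfying Euler's formula  V - E + F = 2 *)
Definition plane_embedding (e : rel V) (sigma : {perm dart e}) :=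
  rotation_system sigma /\
  (forall u v : V, connect e u v) /\
  #|V| + fcard (face_succ sigma) (@predT (dart e)) = #|edges e| + 2.

(* Angles.  The angle (corner) indexed by the dart x is the corner at tail x
   between the darts sigma^-1 x and x; it lies in the face whose boundary walk
   contains x.  So angles at v in cyclic order = sigma-orbit, angles of a face
   in cyclic order = face_succ-orbit.  Label 1 = true, 0 = false. *)

Definition one_interval_each (s : seq bool) :=
  exists k a b, 0 < a /\ 0 < b /\ rot k s = nseq a true ++ nseq b false.

Definition ext_weak_labeling (e : rel V) (sigma : {perm dart e})
    (s0 s1 : V) (lam : dart e -> bool) :=
  (e s0 s1 /\ forall d : dart e,
      (tail d = s0 -> lam d = false) /\ (tail d = s1 -> lam d = true)) /\
  (forall d : dart e, tail d <> s0 -> tail d <> s1 ->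
      one_interval_each (map lam (fingraph.orbit sigma d))) /\
  (* G2': the two sides of edge d are the corners d, sigma d at tail d
     and the corners rev d, sigma (rev d) at head d *)
  (forall d : dart e, [set tail d; head d] != [set s0; s1] ->
      (lam d == lam (sigma d)) != (lam (rev_dart d) == lam (sigma (rev_dart d)))) /\
  (forall d : dart e, one_interval_each (map lam (fingraph.orbit (face_succ sigma) d))).

End Defs.

(* Main.v *)
(** Orient the edges of the Laman graph so that [s1] has out-degree 0, [s0] has
    only the out-edge [s0 s1] and every other vertex has out-degree 2 (Hakimi's
    theorem; the Laman count is exactly the required sparsity).  Let the labels
    around a vertex [v] change precisely at its out-edges other than [s0 s1]: this
    fixes them up to one bit per vertex, and once the bits of [s0] and [s1] are set
    as (G0') requires, (G1) and (G2') hold for every choice of the others.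

    By (G2') every edge other than [s0 s1] contributes one label change to one of
    its two faces, and [s0 s1] contributes one to both, so that the faces see
    [|E| + 1 = 2n - 2] changes in total.  By Euler's formula this is twice the
    number of faces, hence (G3) only asks for bits making no face constant.

    Such bits exist by a sign argument.  For a set of faces not incident to
    [s0 s1] whose boundary graph is connected, independence of the face boundaries
    in the cycle space and the Laman count on the boundary vertices show that there
    are more non-special boundary vertices than faces.  So some non-zero vector [y]
    on these vertices satisfies, for each face, that the sum of [+- y v] over its
    angles vanishes; choosing the bits on the support of [y] by sign gives both
    labels to every face meeting the support, and the other faces are treated
    recursively. *)
From HB Require Import structures.
From mathcomp Require Import all_boot all_order all_algebra fingroup perm.
From mathcomp Require Import zify ring.
Require Import Defs.
Set Implicit Arguments. Unset Strict Implicit. Unset Printing Implicit Defensive.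
Import Order.TTheory GRing.Theory Num.Theory.

Section LinearAlgebra.
Local Open Scope ring_scope.

Lemma underdetermined_system (F : fieldType) (I J : finType)
    (A : {set I}) (B : {set J}) (L : I -> {ffun J -> F^o} -> F) :
  (forall i, scalar (L i)) -> (#|A| < #|B|)%N ->
  exists y : {ffun J -> F^o},
    [/\ exists2 j, j \in B & y j != 0,
        forall j, j \notin B -> y j = 0 &
        {in A, forall i, L i y = 0}].
Proof.
move=> linL ltAB.
pose delta (k : 'I_#|B|) : {ffun J -> F^o} := [ffun j => (j == enum_val k)%:R].
pose N := \matrix_(k < #|B|, i < #|A|) L (enum_val i) (delta k).
have kerN_neq0 : kermx N != 0.
  rewrite -mxrank_eq0 mxrank_ker -lt0n subn_gt0.
  exact: leq_ltn_trans (rank_leq_col N) ltAB.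
have [u uN u_neq0] : exists2 u : 'rV_#|B|, u *m N = 0 & u != 0.
  exists (nz_row (kermx N)); last by rewrite nz_row_eq0.
  by apply/sub_kermxP; exact: nz_row_sub.
pose y := \sum_k u 0 k *: delta k.
have yE j : y j = \sum_k u 0 k * (j == enum_val k)%:R.
  by rewrite /y sum_ffunE; apply: eq_bigr => k _; rewrite !ffunE.
exists y; split.
- have /rV0Pn[k uk] := u_neq0; exists (enum_val k); first exact: enum_valP.
  rewrite yE (bigD1 k) //= eqxx mulr1 big1 ?addr0 // => l lk.
  by rewrite (inj_eq enum_val_inj) eq_sym (negbTE lk) mulr0.
- move=> j; rewrite yE => jB; apply: big1 => k _.
  rewrite (_ : j == _ = false) ?mulr0 //.
  by apply: contraNF jB => /eqP->; apply: enum_valP.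
move=> i iA; have /rowP/(_ (enum_rank_in iA i)) := uN; rewrite !mxE; apply: etrans.
pose Li : {scalar _} := HB.pack (L i) (GRing.isLinear.Build _ _ _ _ _ (linL i)).
rewrite -[L i]/(Li : _ -> _) linear_sum; apply: eq_bigr => k _.
by rewrite linearZ mxE enum_rankK_in.
Qed.

Lemma sum0_both_signs (R : realDomainType) (I : finType) (P : pred I)
    (F : I -> R) i0 :
  \sum_(i | P i) F i = 0 -> P i0 -> F i0 != 0 ->
  (exists2 i, P i & 0 < F i) /\ (exists2 i, P i & F i < 0).
Proof.
have pos (G : I -> R) : \sum_(i | P i) G i = 0 -> P i0 -> G i0 != 0 ->
    exists2 i, P i & 0 < G i.
  move=> sumG Pi0 Gi0; apply/exists_inP; apply: contraNT Gi0.
  rewrite negb_exists_in => /forall_inP noG.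
  have Gle0 i : P i -> 0 <= - G i by move/noG; rewrite oppr_ge0 leNgt.
  have := psumr_eq0P Gle0; rewrite sumrN sumG oppr0 => /(_ erefl i0 Pi0)/eqP.
  by rewrite oppr_eq0.
move=> sumF Pi0 Fi0; split; first exact: pos.
have [||i Pi Fi] := pos (fun i => - F i) _ Pi0.
- by rewrite sumrN sumF oppr0.
- by rewrite oppr_eq0.
by exists i; rewrite // -oppr_gt0.
Qed.

End LinearAlgebra.

Lemma sum_eq_indicator (I : finType) (P : pred I) i : \sum_(j | P j) (j == i) = P i.
Proof.
rewrite -big_mkcondr; case Pi : (P i).
  by rewrite (big_pred1 i) // => j /=; case: eqP => [->|]; rewrite ?Pi ?andbF.
by rewrite big_pred0 // => j; case: eqP => [->|]; rewrite ?Pi ?andbF.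
Qed.

Lemma connect_step_ind (T : finType) (r : rel T) (P : T -> Prop) x :
  P x -> (forall y z, connect r x y -> r y z -> P y -> P z) ->
  forall y, connect r x y -> P y.
Proof.
move=> Px step y /connectP[p]; elim/last_ind: p y => [_ _ -> //|p z IH y].
rewrite rcons_path last_rcons => /andP[xp rz] ->.
by apply: step rz (IH _ xp erefl); apply/connectP; exists p.
Qed.

Lemma sorted_bool (s : seq bool) : sorted (fun a b => b ==> a) s ->
  s = nseq (count id s) true ++ nseq (count negb s) false.
Proof.
elim: s => //= -[] s IH ps; first by rewrite /= -IH //; apply: path_sorted ps.
have /all_pred1P s_false : all (pred1 false) s.
  have : transitive (fun a b => b ==> a) by case=> -[] [].
  by move=> tr; apply: sub_all (order_path_min tr ps) => -[].
by rewrite s_false !count_nseq /= mul1n.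
Qed.

Section Orbits.
Variables (T : finType) (f : T -> T).
Hypothesis injf : injective f.

Definition change (lam : T -> bool) x := lam x != lam (f x).

Definition ascent (lam : T -> bool) x := ~~ lam x && lam (f x).

Definition bichromatic (lam : T -> bool) d :=
  (exists2 x, fconnect f d x & lam x) /\ (exists2 x, fconnect f d x & ~~ lam x).

Lemma bichromatic_neq lam d x y :
  fconnect f d x -> fconnect f d y -> lam x != lam y -> bichromatic lam d.
Proof.
case lx : (lam x); case ly : (lam y) => // dx dy _; split.
- by exists x.
- by exists y; rewrite ?ly.
- by exists y.
- by exists x; rewrite ?lx.
Qed.

Lemma fconnect_fclosed d : fclosed f (fconnect f d).
Proof. exact/connect_closed/fconnect_sym. Qed.

Lemma sum_orbit (F : T -> nat) d :
  \sum_(x in fconnect f d) F x = \sum_(i < fingraph.order f d) F (iter i f d).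
Proof.
transitivity (\sum_(x <- fingraph.orbit f d) F x).
  rewrite (big_uniq _ (orbit_uniq f d)).
  by apply: eq_bigl => x; rewrite -fconnect_orbit.
rewrite (big_nth d) size_orbit big_mkord; apply: eq_bigr => i _.
by rewrite nth_traject.
Qed.

Lemma sum_fclosed (F : T -> nat) (P : {pred T}) : fclosed f P ->
  \sum_(x in P) F (f x) = \sum_(x in P) F x.
Proof.
move=> clP; rewrite [RHS](reindex_inj injf) /=; apply: eq_bigl => x.
exact: (fclosed1 clP).
Qed.

Lemma sum_changes lam (P : {pred T}) : fclosed f P ->
  \sum_(x in P) change lam x = 2 * \sum_(x in P) ascent lam x.
Proof.
move=> clP; apply: (@addIn (\sum_(x in P) lam (f x))).
rewrite [in RHS](sum_fclosed (fun x => lam x)) // big_distrr -!big_split /=.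
by apply: eq_bigr => x _; rewrite /change /ascent; case: (lam x); case: (lam _).
Qed.

Lemma bichromatic_ascent lam d :
  bichromatic lam d -> 0 < \sum_(x in fconnect f d) ascent lam x.
Proof.
case=> -[a da la] [b db lb]; rewrite lt0n sum_nat_eq0; apply: contraL la.
move=> /forall_inP/= no_ascent.
have : fconnect f b a by apply: connect_trans da; rewrite fconnect_sym.
apply: (connect_step_ind (P := fun x => ~~ lam x) lb) => x y bx /eqP <- lx.
have := no_ascent x (connect_trans db bx); rewrite /ascent lx /=.
by case: (lam _).
Qed.

Lemma iter_neq_pred z i :
  i.+1 < fingraph.order f (f z) -> iter i f (f z) != z.
Proof.
by move=> lti; apply/eqP => iz; have := findex_iter lti; rewrite iterS iz findex0.
Qed.

Lemma one_ascent_intervals lam d : \sum_(x in fconnect f d) ascent lam x = 1 ->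
  one_interval_each (map lam (fingraph.orbit f d)).
Proof.
move=> /eqP/sum_nat_eq1[z [dz /eqP]]; rewrite eqb1 => /andP[lz lfz] uniq_z.
have dfz : fconnect f d (f z) by rewrite -same_fconnect1_r.
have [k rotk] := orbit_rot_cycle (cycle_orbit injf d) (orbit_uniq f d)
  (etrans (esym (fconnect_orbit f d (f z))) dfz).
pose s := map lam (fingraph.orbit f (f z)).
have sorted_s : sorted (fun a b => b ==> a) s.
  apply/(sortedP false) => i; rewrite size_map size_orbit => lti.
  have lt_i := ltnW lti.
  rewrite !(nth_map (f z)) ?size_orbit // !nth_traject // iterS.
  have := uniq_z _ (iter_neq_pred lti) (connect_trans dfz (fconnect_iter _ _ _)).
  by rewrite /ascent; case: (lam (iter i f _)); case: (lam _).
exists k, (count id s), (count negb s); rewrite -!has_count; split; last split.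
- by apply/hasP; exists true => //; rewrite -lfz map_f // -fconnect_orbit.
- apply/hasP; exists false => //; rewrite -(negbTE lz) map_f // -fconnect_orbit.
  by rewrite fconnect_sym // fconnect1.
by rewrite -sorted_bool // -map_rot -rotk.
Qed.

(* Every orbit has at least one ascent and the changes allow no more on average. *)
Lemma tight_changes_intervals lam : (forall d, bichromatic lam d) ->
  \sum_x change lam x = 2 * fcard f predT ->
  forall d, one_interval_each (map lam (fingraph.orbit f d)).
Proof.
move=> bilam; rewrite (sum_changes lam (P := predT)) // => /eqP.
rewrite eqn_pmul2l // => /eqP sum_ascents d; apply: one_ascent_intervals.
pose ascents z := \sum_(x in fconnect f z) ascent lam x.
have ascents_gt0 z : 0 < ascents z by apply: bichromatic_ascent.
have rootE : fconnect f d =1 fconnect f (froot f d).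
  by apply: same_connect (connect_root _ d); apply: fconnect_sym.
have sum_roots : \sum_(z | froots f z) ascents z = fcard f predT.
  rewrite -sum_ascents [RHS](partition_big (froot f) (froots f)) /=; last first.
    by move=> x _; apply: roots_root (fconnect_sym injf) x.
  apply: eq_bigr => z /eqP rz; apply: eq_bigl => x.
  by rewrite /= -{2}rz eq_sym (root_connect (fconnect_sym injf)).
have := leqif_sum (fun z (_ : froots f z) => leqif_eq (ascents_gt0 z)).
have -> : \sum_(z | froots f z) 1 = fcard f predT.
  by rewrite sum1dep_card; apply: eq_card => z; rewrite !inE andbT.
case=> _; rewrite sum_roots eqxx => /esym/forall_inP.
move=> /(_ _ (roots_root (fconnect_sym injf) d))/eqP ->.
by apply: eq_bigl; apply: rootE.
Qed.

Lemma orbit_primitive (D lam0 : T -> bool) :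
  (forall d, ~~ odd (\sum_(x in fconnect f d) D x)) ->
  exists lam, change lam =1 D /\ {in froots f, lam =1 lam0}.
Proof.
move=> evenD; have symf := fconnect_sym injf.
pose lam x := let z := froot f x in
  lam0 z (+) odd (\sum_(i < findex f z x) D (iter i f z)).
exists lam; split=> [x|x /eqP rx]; last by rewrite /lam rx findex0 big_ord0 addbF.
have rfx : froot f (f x) = froot f x.
  by apply/(fingraph.rootP symf); rewrite symf fconnect1.
have zx : fconnect f (froot f x) x by rewrite symf connect_root.
rewrite /change /lam rfx negb_eqb addbACA addbb /=.
set z := froot f x in zx *; set n := findex f z x.
have DxE : D x = D (iter n f z) by rewrite iter_findex.
have [ltn|gen] := ltnP n.+1 (fingraph.order f z).
  rewrite (_ : findex f z (f x) = n.+1); last first.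
    by rewrite -(iter_findex zx) -iterS findex_iter.
  by rewrite big_ord_recr oddD /= -DxE oddb addKb.
have nE : n.+1 = fingraph.order f z.
  by apply/eqP; rewrite eqn_leq gen andbT findex_max.
rewrite -(iter_findex zx) -iterS -/n nE iter_order // findex0 big_ord0 addbF.
have := evenD z; rewrite sum_orbit -nE big_ord_recr oddD /= -DxE oddb.
by case: (odd _); case: (D x).
Qed.

End Orbits.

Section SignSwitching.
Local Open Scope ring_scope.
Variables (R : realDomainType) (T V : finType) (f : T -> T) (t : T -> V).
Hypothesis injf : injective f.
Variable lam : T -> bool.

Definition switch (b : V -> bool) x := lam x (+) b (t x).

Definition signed_orbit_sum (y : V -> R) d :=
  \sum_(x in fconnect f d) (-1) ^+ lam x * y (t x).

Lemma switch_by_sign (y : V -> R) (b : V -> bool) x :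
  (forall v, y v != 0 -> b v = (y v < 0)) -> y (t x) != 0 ->
  switch b x = ((-1) ^+ lam x * y (t x) < 0).
Proof. by move=> b_sign yx; rewrite mulr_lt0 signr_eq0 signr_lt0 yx /switch b_sign. Qed.

Lemma bichromatic_switch_by_sign (y : V -> R) b d :
  (forall v, y v != 0 -> b v = (y v < 0)) -> signed_orbit_sum y d = 0 ->
  (exists2 x, fconnect f d x & y (t x) != 0) -> bichromatic f (switch b) d.
Proof.
move=> b_sign sum0 [x dx yx].
have term_neq0 z : ((-1) ^+ lam z * y (t z) != 0) = (y (t z) != 0).
  by rewrite mulf_eq0 signr_eq0.
have [||[z dz pos_z] [w dw neg_w]] := sum0_both_signs sum0 (i0 := x).
- exact: dx.
- by rewrite term_neq0.
split; [exists w | exists z] => //; rewrite (switch_by_sign b_sign) //.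
- by rewrite -term_neq0 lt_eqF.
- by rewrite -leNgt ltW.
- by rewrite -term_neq0 gt_eqF.
Qed.

(* Seymour's linear algebra method for 2-colouring set systems with more points
   than sets: colour the support of a kernel vector by sign, and recurse on the
   orbits that miss the support. *)
Lemma bichromatic_switching (K : {set V}) (D : {set T}) :
  (forall S : {set T}, fclosed f S -> S \subset D -> S != set0 ->
   exists y : V -> R, [/\ {in K, forall v, y v = 0},
     exists2 d, d \in S & y (t d) != 0 &
     {in S, forall d, signed_orbit_sum y d = 0}]) ->
  fclosed f D ->
  exists b : V -> bool,
    {in K, b =1 xpred0} /\ {in D, forall d, bichromatic f (switch b) d}.
Proof.
move=> kernel; have [m] := ubnP #|D|.
elim: m D kernel => // m IH D kernel; rewrite ltnS => leDm clD.
have [->|D0] := eqVneq D set0; first by exists xpred0; split=> // d; rewrite inE.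
have [y [yK [d0 d0D yd0] ysum]] := kernel D clD (subxx D) D0.
pose D' := [set d in D | [forall x in fconnect f d, y (t x) == 0]].
have subD' : D' \subset D by apply/subsetP => d; rewrite inE => /andP[].
have clD' : fclosed f D'.
  move=> x _ /eqP <-; rewrite !inE -(fclosed1 clD); congr andb.
  apply: eq_forallb => z; congr (_ ==> _).
  exact: same_fconnect1.
have [||b [bK biD']] := IH D' _ _ clD'.
- by move=> S clS subS; apply: kernel => //; apply: subset_trans subD'.
- apply: leq_trans leDm; apply/proper_card/properP; split=> //.
  exists d0 => //; rewrite inE d0D /=; apply/forall_inPn; exists d0 => //.
  exact: connect0.
exists (fun v => if y v == 0 then b v else y v < 0).
split=> [v vK|d dD]; first by rewrite yK // eqxx bK.
have [/forall_inP y0|/forall_inPn[x dx yx]] :=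
  boolP [forall x in fconnect f d, y (t x) == 0].
  have [|[x dx bx] [z dz bz]] := biD' d; first by rewrite inE dD; apply/forall_inP.
  by split; [exists x | exists z] => //; rewrite /switch y0.
apply: (bichromatic_switch_by_sign (y := y)); [|exact: ysum|by exists x].
by move=> v /negbTE->.
Qed.

End SignSwitching.

Section Darts.
Variables (V : finType) (e : rel V).
Hypothesis simple_e : simple_graph e.

Lemma tail_rev (d : dart e) : tail (rev_dart d) = head d.
Proof.
have [es _] := simple_e; rewrite /tail /rev_dart val_insubd /=.
by rewrite es (valP d).
Qed.

Lemma head_rev (d : dart e) : head (rev_dart d) = tail d.
Proof.
have [es _] := simple_e; rewrite /head /rev_dart val_insubd /=.
by rewrite es (valP d).
Qed.

Lemma dart_inj (d d' : dart e) : tail d = tail d' -> head d = head d' -> d = d'.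
Proof.
rewrite /tail /head => ht hh; apply: val_inj.
by rewrite [LHS]surjective_pairing ht hh -surjective_pairing.
Qed.

Lemma rev_dartK : involutive (@rev_dart V e).
Proof. by move=> d; apply: dart_inj; rewrite !(tail_rev, head_rev). Qed.

Lemma rev_dart_inj : injective (@rev_dart V e).
Proof. exact: inv_inj rev_dartK. Qed.

Lemma tail_neq_head (d : dart e) : tail d != head d.
Proof.
have [_ ir] := simple_e; apply: contraTneq (valP d).
by rewrite /tail /head => ->; rewrite ir.
Qed.

Lemma rev_dart_neq (d : dart e) : rev_dart d != d.
Proof. by apply: contraNneq (tail_neq_head d) => rev_d; rewrite -tail_rev rev_d. Qed.

Lemma dart_of_edge u v : e u v -> exists d : dart e, tail d = u /\ head d = v.
Proof. by move=> uv; exists (Sub (u, v) uv). Qed.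

Definition same_edge (d d' : dart e) := (d == d') || (d == rev_dart d').

Lemma same_edge_rev d d' : same_edge (rev_dart d) d' = same_edge d d'.
Proof.
by rewrite /same_edge orbC (inj_eq rev_dart_inj) (can2_eq rev_dartK rev_dartK).
Qed.

Lemma eq_endpoints d d' :
  ([set tail d; head d] == [set tail d'; head d']) = same_edge d d'.
Proof.
apply/eqP/orP => [eq_ends|[]/eqP->]; rewrite ?tail_rev ?head_rev // 1?setUC //.
have := set21 (tail d) (head d); have := set22 (tail d) (head d).
rewrite eq_ends !inE => /orP[]/eqP hd /orP[]/eqP td.
- by have := tail_neq_head d; rewrite td hd eqxx.
- by right; apply/eqP/dart_inj; rewrite ?tail_rev ?head_rev.
- by left; apply/eqP/dart_inj.
- by have := tail_neq_head d; rewrite td hd eqxx.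
Qed.

Lemma dart_ends_card_gt1 (R : {set V}) (d : dart e) :
  tail d \in R -> head d \in R -> 2 <= #|R|.
Proof.
move=> tR hR; apply: leq_trans (subset_leq_card (_ : [set tail d; head d] \subset R)).
  by rewrite cards2 tail_neq_head.
by rewrite subUset !sub1set tR hR.
Qed.

Definition orientation (o : dart e -> bool) := forall d, o (rev_dart d) = ~~ o d.

Definition outdeg (o : dart e -> bool) v := \sum_(d | tail d == v) o d.

Lemma orientation_exists : exists o, orientation o.
Proof.
exists (fun d => enum_rank (tail d) < enum_rank (head d)) => d.
rewrite tail_rev head_rev -leqNgt ltn_neqAle (inj_eq val_inj).
by rewrite (inj_eq enum_rank_inj) eq_sym tail_neq_head.
Qed.

Lemma orientation_through d : exists2 o, orientation o & o d.
Proof.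
have [o oo] := orientation_exists; have [od|nod] := boolP (o d); first by exists o.
by exists (fun x => ~~ o x) => // x; rewrite oo.
Qed.

Lemma sum_oriented_darts o (F : dart e -> nat) : orientation o ->
  \sum_d F d = \sum_(d | o d) (F d + F (rev_dart d)).
Proof.
move=> oo; rewrite (bigID o) big_split; congr (_ + _) => /=.
by rewrite (reindex_inj rev_dart_inj); apply: eq_bigl => d; rewrite oo negbK.
Qed.

Lemma sum_outdeg o (R : {set V}) :
  \sum_(v in R) outdeg o v = #|[set d | o d & tail d \in R]|.
Proof.
rewrite cardsE -sum1_card (partition_big (@tail V e) (mem R)) => [|d /andP[] //].
apply: eq_bigr => v vR; rewrite /outdeg big_mkcond [RHS]big_mkcond.
apply: eq_bigr => d _; rewrite unfold_in /= andbAC.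
by case: eqP => [->|]; rewrite ?vR ?andbF ?andbT //; case: (o d).
Qed.

Lemma card_induced_edges o (R : {set V}) : orientation o ->
  #|[set d | [&& o d, tail d \in R & head d \in R]]| = #|induced_edges e R|.
Proof.
move=> oo; rewrite -(@card_in_imset _ _ (fun d : dart e => [set tail d; head d])).
  apply: eq_card => E; apply/imsetP/imsetP.
    move=> [d]; rewrite inE => /and3P[od td hd] ->; exists (val d) => //.
    by rewrite inE td hd (valP d).
  case=> -[u v]; rewrite inE /= => /and3P[uR vR uv] ->.
  have [d [td hd]] := dart_of_edge uv.
  have [od|nod] := boolP (o d); first by exists d; rewrite ?inE ?od td hd ?uR ?vR.
  exists (rev_dart d); rewrite ?inE ?oo tail_rev head_rev td hd ?nod ?uR ?vR //.
  exact: setUC.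
move=> d d'; rewrite !inE => /and3P[od _ _] /and3P[od' _ _] /eqP.
rewrite eq_endpoints => /orP[]/eqP // dE.
by rewrite dE oo od' in od.
Qed.

Lemma edgesE : edges e = induced_edges e setT.
Proof.
by apply/setP => x; apply/imsetP/imsetP => -[p]; rewrite !inE => pe ->;
   exists p; rewrite ?inE.
Qed.

Lemma card_oriented_darts o : orientation o -> #|[set d : dart e | o d]| = #|edges e|.
Proof.
move=> oo; rewrite edgesE -(card_induced_edges setT oo).
by apply: eq_card => d; rewrite !inE !andbT.
Qed.

Section Hakimi.

Definition flip (o : dart e -> bool) d x := o x (+) same_edge x d.

Lemma flip_orientation o d : orientation o -> orientation (flip o d).
Proof. by move=> oo x; rewrite /flip oo same_edge_rev addNb. Qed.

Lemma flipE o d x : orientation o -> o d ->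
  flip o d x + (x == d) = o x + (x == rev_dart d).
Proof.
move=> oo od; rewrite /flip /same_edge.
have [->|_] := eqVneq x d; first by rewrite od eq_sym (negbTE (rev_dart_neq d)).
by have [->|_] := eqVneq x; rewrite ?oo ?od ?addbF.
Qed.

Lemma outdeg_flip o d v : orientation o -> o d ->
  outdeg (flip o d) v + (v == tail d) = outdeg o v + (v == head d).
Proof.
move=> oo od; rewrite -tail_rev ![v == _]eq_sym.
rewrite -2!(sum_eq_indicator (fun x : dart e => tail x == v)) -!big_split /=.
by apply: eq_bigr => x _; apply: flipE.
Qed.

Definition out_rel (o : dart e -> bool) u v :=
  [exists d, [&& o d, tail d == u & head d == v]].

Lemma out_rel_flip o d : orientation o ->
  {in predC1 (tail d) &, subrel (out_rel o) (out_rel (flip o d))}.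
Proof.
move=> oo u v ud vd /existsP[x /and3P[ox /eqP tx /eqP hx]].
apply/existsP; exists x; rewrite tx hx !eqxx !andbT /flip ox addTb.
apply/norP; split; first by apply: contraNneq ud => <-; rewrite tx.
by apply: contraNneq vd => xd; rewrite -hx xd head_rev.
Qed.

Lemma reverse_path o v p : orientation o -> path (out_rel o) v p -> uniq (v :: p) ->
  exists2 o', orientation o' &
    forall x, outdeg o' x + (x == v) = outdeg o x + (x == last v p).
Proof.
elim: p o v => [|w p IH] o v oo; first by exists o.
move=> /= /andP[/existsP[d /and3P[od /eqP td /eqP hd]] wp] /andP[vwp up].
have wp' : path (out_rel (flip o d)) w p.
  apply: (sub_in_path (P := predC1 v)) wp; first by rewrite -td; apply: out_rel_flip.
  by apply/allP => x xp; rewrite inE; apply: contraNneq vwp => <-.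
have [o' oo' deg'] := IH _ _ (flip_orientation d oo) wp' up.
exists o' => // x; have := outdeg_flip x oo od; rewrite td hd => degd.
by apply: (@addIn (x == w)); rewrite addnAC deg' addnAC degd addnAC.
Qed.

Variable bound : V -> nat.

Definition excess o := \sum_v (outdeg o v - bound v).

Lemma excess_decreases o o' u v :
  (forall x, outdeg o' x + (x == v) = outdeg o x + (x == u)) ->
  bound v < outdeg o v -> outdeg o u < bound u -> excess o' < excess o.
Proof.
move=> deg excess_v deficit_u; rewrite -addn1 -[1](sum_eq_indicator xpredT v).
rewrite -big_split; apply: leq_sum => x _ /=; have := deg x.
by case: eqP => [->|_]; case: eqP => [vu|_]; subst; lia.
Qed.

Lemma reachable_outdeg o v :
  let R := [set u | connect (out_rel o) v u] in orientation o ->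
  \sum_(u in R) outdeg o u = #|induced_edges e R|.
Proof.
move=> R oo; rewrite sum_outdeg -(card_induced_edges R oo).
apply: eq_card => d; rewrite !inE; case od : (o d) => //=.
case td : (connect _ _ (tail d)) => //=; symmetry.
by apply: connect_trans td (connect1 _); apply/existsP; exists d; rewrite od !eqxx.
Qed.

Lemma hakimi_orientation :
  (forall R : {set V}, #|induced_edges e R| <= \sum_(v in R) bound v) ->
  exists2 o, orientation o & forall v, outdeg o v <= bound v.
Proof.
move=> sparse; have [o oo] := orientation_exists.
have [m] := ubnP (excess o); elim: m o oo => // m IH o oo; rewrite ltnS => lem.
have [/forallP bounded|] := boolP [forall v, outdeg o v <= bound v]; first by exists o.
rewrite negb_forall => /existsP[v]; rewrite -ltnNge => excess_v.
have [/existsP[u /andP[/connectP[p vp uE] deficit_u]]|] :=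
    boolP [exists u, connect (out_rel o) v u && (outdeg o u < bound u)].
  move: deficit_u; rewrite uE; case/shortenP: vp => q vq uq _ deficit_u.
  have [o' oo' deg'] := reverse_path oo vq uq.
  apply: (IH o') => //; apply: leq_trans lem.
  exact: excess_decreases deg' excess_v deficit_u.
rewrite negb_exists => /forallP saturated.
pose R := [set u | connect (out_rel o) v u].
have vR : v \in R by rewrite inE connect0.
have := sparse R; rewrite -reachable_outdeg // leqNgt => /negP[].
rewrite (bigD1 v) //= [in ltnRHS](bigD1 v) //= -addSn; apply: leq_add => //.
apply: leq_sum => u /andP[uR _]; have := saturated u.
by rewrite inE in uR; rewrite uR -leqNgt.
Qed.

End Hakimi.
End Darts.

Section Faces.
Variables (V : finType) (e : rel V) (sigma : {perm dart e}).
Hypothesis simple_e : simple_graph e.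
Hypothesis rot_sigma : rotation_system sigma.
Notation phi := (face_succ sigma).

Lemma face_succ_inj : injective phi.
Proof. by move=> d d' /perm_inj /(rev_dart_inj simple_e). Qed.

Lemma tail_face_succ d : tail (phi d) = head d.
Proof. by have [ts _] := rot_sigma; rewrite /face_succ ts tail_rev. Qed.

Lemma face_succ_rev d : phi (rev_dart d) = sigma d.
Proof. by rewrite /face_succ rev_dartK. Qed.

Lemma fconnect_rotation d d' : fconnect sigma d d' = (tail d' == tail d).
Proof.
have [ts cs] := rot_sigma; apply/idP/eqP => [dd'|/esym/cs //]; symmetry.
by apply: fconnect_invariant dd' => x /=; rewrite ts eqxx.
Qed.

Section Potentials.
Local Open Scope ring_scope.
Variables (R : realDomainType) (x : dart e -> R).
Hypothesis x_face : forall d, x (phi d) = x d.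

(* [x d - x (rev_dart d)] is both a circulation and a potential difference, so it
   is orthogonal to itself. *)
Lemma face_potential_rev (p : V -> R) :
  (forall d, x d != x (rev_dart d) ->
     x d - x (rev_dart d) = p (tail d) - p (head d)) ->
  forall d, x (rev_dart d) = x d.
Proof.
pose g d := x d - x (rev_dart d) => gE.
have circulation : \sum_d g d * p (tail d) = 0.
  under eq_bigr do rewrite mulrBl.
  rewrite sumrB; apply/eqP; rewrite subr_eq0; apply/eqP.
  rewrite (reindex_inj (@perm_inj _ sigma)); apply: eq_bigr => d _.
  by rewrite -{1}face_succ_rev x_face; have [-> _] := rot_sigma.
have circulation_rev : \sum_d g d * p (head d) = 0.
  apply: oppr_inj; rewrite oppr0 -[RHS]circulation -sumrN.
  rewrite (reindex_inj (rev_dart_inj simple_e)); apply: eq_bigr => d _.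
  by rewrite /g rev_dartK // head_rev // -mulNr opprB.
have norm0 : \sum_d g d ^+ 2 = 0.
  transitivity (\sum_d g d * p (tail d) - \sum_d g d * p (head d)); last first.
    by rewrite circulation circulation_rev subrr.
  rewrite -sumrB; apply: eq_bigr => d _; rewrite -mulrBr expr2.
  have [xd|/gE <- //] := eqVneq (x d) (x (rev_dart d)).
  by rewrite /g xd subrr !mul0r.
move=> d; have /eqP : g d ^+ 2 = 0.
  by apply: (psumr_eq0P _ norm0) => // i _; exact: sqr_ge0.
by rewrite sqrf_eq0 subr_eq0 => /eqP.
Qed.

Lemma face_potential_const : (forall u v, connect e u v) ->
  (forall d, x (rev_dart d) = x d) -> forall d d', x d = x d'.
Proof.
move=> conn_e xrev.
have xtail d d' : tail d = tail d' -> x d = x d'.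
  move=> dd'; apply: (fconnect_invariant (f := sigma)); last first.
    by rewrite fconnect_rotation dd'.
  by move=> y /=; rewrite -face_succ_rev x_face xrev eqxx.
suff xpath u v d d' : connect e u v -> tail d = u -> tail d' = v -> x d = x d'.
  by move=> d d'; apply: xpath (conn_e _ _) erefl erefl.
case/connectP=> q; elim: q u d => [|w q IH] u d /=.
  by move=> _ -> td td'; apply: xtail; rewrite td td'.
case/andP=> /(dart_of_edge (e := e))[a [ta ha]] wq vE td td'.
rewrite (xtail d a) ?td ?ta // -xrev.
by apply: IH wq vE _ td'; rewrite tail_rev.
Qed.

End Potentials.

Definition boundary_step (S : {set dart e}) : rel (dart e) :=
  [rel d d' | [&& d \in S, d' \in S & (d' == phi d) || (tail d == tail d')]].

Definition boundary_connected (S : {set dart e}) d0 :=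
  {in S, forall d, connect (boundary_step S) d0 d}.

Section BoundaryCard.
Variables (T E : {set dart e}) (d0 dout : dart e).
Hypothesis conn_e : forall u v, connect e u v.
Hypotheses (clT : fclosed phi T) (conT : boundary_connected T d0).
Hypothesis outT : dout \notin T.
Hypothesis coverT : {in T, forall d, (d \in E) || (rev_dart d \in E)}.

Lemma boundary_potentials_eq0 (R : realDomainType) (x : dart e -> R) (p : V -> R) :
  (forall d, x (phi d) = x d) -> (forall d, d \notin T -> x d = 0%R) ->
  p (tail d0) = 0%R ->
  {in E, forall d, x d - x (rev_dart d) = p (tail d) - p (head d)}%R ->
  {in T, forall d, x d = 0%R /\ p (tail d) = 0%R}.
Proof.
move=> x_face x_out p_d0 eqE.
pose balanced d := (x d - x (rev_dart d) = p (tail d) - p (head d))%R.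
have balanced_rev d : balanced (rev_dart d) -> balanced d.
  rewrite /balanced rev_dartK // tail_rev // head_rev // => eqd.
  by apply: oppr_inj; rewrite !opprB.
have balanced_T d : d \in T -> balanced d.
  by case/coverT/orP => [/eqE //|/eqE]; apply: balanced_rev.
have x_rev : forall d, x (rev_dart d) = x d.
  apply: (face_potential_rev x_face (p := p)) => d.
  have [/balanced_T //|dT] := boolP (d \in T).
  have [/balanced_T/balanced_rev //|rdT] := boolP (rev_dart d \in T).
  by rewrite !x_out // eqxx.
have x0 d : x d = 0%R.
  by rewrite (face_potential_const x_face conn_e x_rev d dout) x_out.
move=> d /conT d0d; split=> //.
apply: (connect_step_ind (P := fun d => p (tail d) = 0%R)) d0d => // y z _.
case/and3P=> yT _ /orP[/eqP->|/eqP<- //] py.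
have := balanced_T y yT; rewrite /balanced !x0 py tail_face_succ.
by rewrite subrr sub0r => /esym/eqP; rewrite oppr_eq0 => /eqP.
Qed.

(* Independence of the face boundaries in the cycle space: otherwise a non-zero pair
   of face and vertex potentials would have the same differences across [E]. *)
Lemma face_boundary_card : fcard phi T + #|@tail V e @: T| <= #|E| + 1.
Proof.
set W := _ @: T; rewrite leqNgt; apply/negP => lt.
have symf := fconnect_sym face_succ_inj.
pose B : {set dart e + V} := [set z | match z with
  | inl d => froots phi d && (d \in T) | inr w => (w != tail d0) && (w \in W) end].
pose defect d (y : {ffun dart e + V -> rat^o}) : rat :=
  (y (inl (froot phi d)) - y (inl (froot phi (rev_dart d)))
   - (y (inr (tail d)) - y (inr (head d))))%R.
have defect_linear d : scalar (defect d).
  by move=> a u v; rewrite /defect !ffunE /GRing.scale /=; ring.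
have cardB : #|B| = fcard phi T + #|W :\ tail d0|.
  rewrite /n_comp_mem -!sum1_card big_mkcond big_sumType /= -!big_mkcond /=.
  by congr (_ + _); apply: eq_bigl => z; rewrite !inE.
have [|y [[z zB yz] yB ysol]] :=
    underdetermined_system (A := E) (B := B) defect_linear.
  by rewrite cardB; have := cardsD1 (tail d0) W; lia.
have rootT d : (froot phi d \in T) = (d \in T).
  by rewrite (closed_connect clT (connect_root _ d)).
have potentials0 := @boundary_potentials_eq0 _
  (fun d => y (inl (froot phi d)) : rat) (fun w => y (inr w) : rat).
have {}potentials0 :
    {in T, forall d, y (inl (froot phi d)) = 0%R /\ y (inr (tail d)) = 0%R}.
  apply: potentials0 => [d|d dT||d /ysol/subr0_eq //].
  - congr (y (inl _)); apply/(fingraph.rootP symf).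
    by rewrite symf fconnect1.
  - by apply: yB; rewrite inE rootT (negbTE dT) andbF.
  - by apply: yB; rewrite inE eqxx.
case: z zB yz => [d|w]; rewrite inE => /andP[].
  by move=> /eqP rd dT; rewrite -rd (potentials0 d dT).1 eqxx.
by move=> _ /imsetP[d dT ->]; rewrite (potentials0 d dT).2 eqxx.
Qed.

End BoundaryCard.

Definition boundary_component (S : {set dart e}) d0 :=
  [set d | connect (boundary_step S) d0 d].

Section Component.
Variables (S : {set dart e}) (d0 : dart e).
Hypotheses (clS : fclosed phi S) (d0S : d0 \in S).
Notation comp := (boundary_component S d0).

Lemma boundary_component_sub : comp \subset S.
Proof.
apply/subsetP => d; rewrite inE.
by apply: (connect_step_ind (P := fun d => d \in S)) => // x y _ /and3P[].
Qed.

Lemma boundary_component_step d d' :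
  d \in comp -> boundary_step S d d' -> d' \in comp.
Proof. by rewrite !inE => d0d /connect1; apply: connect_trans. Qed.

Lemma boundary_component_fclosed : fclosed phi comp.
Proof.
apply: (intro_closed (fconnect_sym face_succ_inj)) => d _ /eqP<- dC.
apply: (boundary_component_step dC).
have dS := subsetP boundary_component_sub d dC.
by apply/and3P; rewrite -(fclosed1 clS) dS eqxx.
Qed.

Lemma boundary_component_tail d : d \in S ->
  tail d \in @tail V e @: comp -> d \in comp.
Proof.
move=> dS /imsetP[d' d'C tdE]; apply: (boundary_component_step d'C).
by apply/and3P; rewrite dS (subsetP boundary_component_sub) // tdE eqxx orbT.
Qed.

Lemma boundary_component_connected : boundary_connected comp d0.
Proof.
move=> d; rewrite inE.
apply: (connect_step_ind (P := connect (boundary_step comp) d0)) => // x y.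
move=> d0x xy d0x_comp; apply: connect_trans d0x_comp (connect1 _).
have xC : x \in comp by rewrite inE.
have yC := boundary_component_step xC xy.
by have /and3P[_ _ link] := xy; apply/and3P; rewrite xC yC.
Qed.

End Component.
End Faces.

Section Laman.
Variables (V : finType) (e : rel V).
Hypothesis simple_e : simple_graph e.
Hypothesis laman_e : laman e.

Lemma laman_has_dart : 0 < #|{: dart e}|.
Proof.
have [cE _] := laman_e; have : 0 < #|edges e| by lia.
case/card_gt0P => E /imsetP[[u v]]; rewrite inE => /(dart_of_edge (e := e))[d _] _.
by apply/card_gt0P; exists d.
Qed.

Lemma laman_face_count (sigma : {perm dart e}) : plane_embedding sigma ->
  #|edges e| + 1 = 2 * fcard (face_succ sigma) predT.
Proof.
case=> _ [_]; have [] := laman_e.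
by move: (fcard _ _) #|edges e| => F m; lia.
Qed.

Variable d01 : dart e.
Notation s0 := (tail d01).
Notation s1 := (head d01).

Definition laman_outdeg v := if v == s1 then 0 else if v == s0 then 1 else 2.

Lemma sum_laman_outdeg (R : {set V}) :
  \sum_(v in R) laman_outdeg v + (2 * (s1 \in R) + (s0 \in R)) = 2 * #|R|.
Proof.
rewrite -2!sum_eq_indicator big_distrr -!big_split /= mulnC -sum_nat_const.
apply: eq_bigr => v _; rewrite /laman_outdeg.
have [->|_] := eqVneq v s1; last by case: eqP.
by rewrite eq_sym (negbTE (tail_neq_head simple_e d01)).
Qed.

Lemma induced_edges_le_laman_outdeg (R : {set V}) :
  #|induced_edges e R| <= \sum_(v in R) laman_outdeg v.
Proof.
have [_ sparse] := laman_e; have := sum_laman_outdeg R.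
have [large|small] := leqP 2 #|R|.
  by have := sparse R large; case: (s0 \in R); case: (s1 \in R); lia.
move=> _; have [o oo] := orientation_exists simple_e.
rewrite -(card_induced_edges simple_e R oo) eq_card0 // => d; rewrite !inE.
apply: contraTF small => /and3P[_ td hd].
by rewrite -leqNgt (dart_ends_card_gt1 simple_e td hd).
Qed.

Lemma laman_orientation :
  exists2 o : dart e -> bool, orientation o & outdeg o =1 laman_outdeg.
Proof.
have [o oo bounded] := hakimi_orientation simple_e induced_edges_le_laman_outdeg.
exists o => // v; have [cE _] := laman_e.
have sumE : \sum_(v in setT) outdeg o v = \sum_(v in setT) laman_outdeg v.
  rewrite sum_outdeg (_ : #|_| = #|edges e|); last first.
    rewrite -(card_oriented_darts simple_e oo).
    by apply: eq_card => d; rewrite !inE andbT.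
  by have := sum_laman_outdeg setT; rewrite !in_setT cardsT; lia.
have [_] := leqif_sum (fun v (_ : v \in setT) => leqif_eq (bounded v)).
by rewrite sumE eqxx => /esym/forall_inP/(_ v (in_setT v))/eqP.
Qed.

Lemma laman_out_darts : exists out : dart e -> bool,
  (forall d, out d (+) out (rev_dart d) = ~~ same_edge d d01) /\
  (forall v, outdeg out v = if v \in [set s0; s1] then 0 else 2).
Proof.
have [o oo odeg] := laman_orientation.
have o_s1 d : tail d = s1 -> o d = false.
  move=> td; have /eqP := odeg s1.
  rewrite /laman_outdeg eqxx sum_nat_eq0 => /forall_inP/(_ d).
  by rewrite td eqxx eqb0 => /(_ isT)/negbTE.
have od01 : o d01 by rewrite -[o d01]negbK -(oo d01) o_s1 // tail_rev.
exists (fun d => o d && (d != d01)); split=> [d|v].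
  rewrite (can2_eq (rev_dartK simple_e) (rev_dartK simple_e)) /same_edge oo.
  have [->|_] := eqVneq d d01; first by rewrite eq_sym rev_dart_neq // od01.
  by have [->|_] := eqVneq d (rev_dart d01); rewrite ?oo ?od01 //; case: (o d).
have := odeg v; rewrite {1}/outdeg (_ : \sum_(_ | _) _ =
    outdeg (fun d => o d && (d != d01)) v + (v == s0)); last first.
  rewrite [v == s0]eq_sym -(sum_eq_indicator (fun d : dart e => tail d == v)).
  rewrite -big_split; apply: eq_bigr => d _ /=.
  by have [->|_] := eqVneq d d01; rewrite ?od01 ?andbT ?addn0.
rewrite /laman_outdeg !inE.
have [->|_] := eqVneq v s1; first by rewrite orbT; lia.
by case: eqP => _ /=; lia.
Qed.

Section Embedding.
Variable sigma : {perm dart e}.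
Hypothesis rot_sigma : rotation_system sigma.
Hypothesis conn_e : forall u v : V, connect e u v.
Notation phi := (face_succ sigma).

Lemma connected_faces_lt (T : {set dart e}) d0 :
  fclosed phi T -> d0 \in T -> boundary_connected sigma T d0 ->
  d01 \notin T -> rev_dart d01 \notin T ->
  fcard phi T < #|(@tail V e @: T) :\: [set s0; s1]|.
Proof.
move=> clT d0T conT d01T rd01T; set W := _ @: T.
have [o oo od01] := orientation_through simple_e d01.
pose I := [set d | [&& o d, tail d \in W & head d \in W]].
have tailW d : d \in T -> tail d \in W by apply: imset_f.
have headW d : d \in T -> head d \in W.
  by rewrite (fclosed1 clT) -(tail_face_succ simple_e rot_sigma) => /tailW.
have coverT : {in T, forall d, (d \in I :\ d01) || (rev_dart d \in I :\ d01)}.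
  move=> d dT; rewrite !inE tail_rev // head_rev // tailW // headW // oo !andbT.
  have -> : d != d01 by apply: contraNneq d01T => <-.
  have -> : rev_dart d != d01 by apply: contraNneq rd01T => <-; rewrite rev_dartK.
  exact: orbN.
have := face_boundary_card simple_e rot_sigma conn_e clT conT d01T coverT.
rewrite -/W; have [_ sparse] := laman_e.
have := sparse W (dart_ends_card_gt1 simple_e (tailW _ d0T) (headW _ d0T)).
rewrite -(card_induced_edges simple_e W oo) (cardsD1 d01 I) inE od01 /=.
have := cardsD1 s0 W; have := cardsD1 s1 (W :\ s0).
rewrite setDDl in_setD1 eq_sym tail_neq_head //=.
move: #|_ :\: _| #|_ :\ s0| #|W| #|_ :\ d01| (fcard _ _) => w2 w1 w i t.
by case: (s0 \in W); case: (s1 \in W); lia.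
Qed.

Lemma boundary_kernel (R : realFieldType) (lam : dart e -> bool) (S : {set dart e}) :
  fclosed phi S -> S != set0 -> d01 \notin S -> rev_dart d01 \notin S ->
  exists y : V -> R, [/\ {in [set s0; s1], forall v, y v = 0%R},
    exists2 d, d \in S & y (tail d) != 0%R &
    {in S, forall d, signed_orbit_sum phi (@tail V e) lam y d = 0%R}].
Proof.
move=> clS /set0Pn[d0 d0S] d01S rd01S; pose T := boundary_component sigma S d0.
have subTS := boundary_component_sub sigma d0S.
have clT := boundary_component_fclosed simple_e clS d0S.
have conT : boundary_connected sigma T d0 by apply: boundary_component_connected.
have d0T : d0 \in T by rewrite inE connect0.
have lt := connected_faces_lt clT d0T conT (contra (subsetP subTS _) d01S)
  (contra (subsetP subTS _) rd01S).
pose L d (y : {ffun V -> R^o}) : R := signed_orbit_sum phi (@tail V e) lam y d.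
have linL d : scalar (L d).
  move=> a u v; rewrite /L /signed_orbit_sum mulr_sumr -big_split.
  by apply: eq_bigr => x _; rewrite !ffunE /= mulrDr mulrCA.
have [|y [[v vW yv] yW ysol]] := underdetermined_system
    (A := [set d | froots phi d && (d \in T)]) linL (leq_ltn_trans _ lt).
  by apply: eq_leq; apply: eq_card => d; rewrite !inE.
exists y; split.
- by move=> s sS; apply: yW; rewrite inE sS.
- move: vW; rewrite inE => /andP[_ /imsetP[d dT vE]].
  by exists d; rewrite -?vE // (subsetP subTS).
move=> d dS; have [dT|dT] := boolP (d \in T).
  have symf := fconnect_sym (face_succ_inj (sigma := sigma) simple_e).
  rewrite -(ysol (froot phi d)).
    by apply: eq_bigl; apply: same_connect (connect_root _ d).
  rewrite !inE (roots_root symf) /=.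
  by have := closed_connect clT (connect_root _ d); rewrite dT inE.
apply: big1 => x dx; rewrite yW ?mulr0 // inE negb_and; apply/orP; right.
apply: contra dT => xW; rewrite (closed_connect clT dx).
by apply: boundary_component_tail xW; rewrite // -(closed_connect clS dx).
Qed.

Variable out : dart e -> bool.
Hypothesis out_edge : forall d, out d (+) out (rev_dart d) = ~~ same_edge d d01.
Hypothesis out_deg : forall v, outdeg out v = if v \in [set s0; s1] then 0 else 2.

Definition special_labels (lam : dart e -> bool) :=
  forall d, (tail d = s0 -> lam d = false) /\ (tail d = s1 -> lam d = true).

Lemma special_labels_neq lam x y d : special_labels lam -> same_edge d d01 ->
  tail x = tail d -> tail y = head d -> lam x != lam y.
Proof.
move=> special /orP[]/eqP-> tx ty.
  by rewrite (special x).1 // (special y).2.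
rewrite tail_rev // in tx; rewrite head_rev // in ty.
by rewrite (special x).2 // (special y).1.
Qed.

Lemma out_special d : tail d \in [set s0; s1] -> out d = false.
Proof.
move=> td; have /eqP := out_deg (tail d).
rewrite td sum_nat_eq0 => /forall_inP/(_ d (eqxx _)).
by rewrite eqb0 => /negbTE.
Qed.

Lemma sum_out_rotation d :
  \sum_(x in fconnect sigma d) out x = if tail d \in [set s0; s1] then 0 else 2.
Proof. by rewrite -out_deg; apply: eq_bigl => x; exact: fconnect_rotation. Qed.

Lemma special_rotation_primitive : exists r, change sigma r =1 out /\
  forall d, tail d \in [set s0; s1] -> r d = (tail d == s1).
Proof.
have [|r [changeE rootE]] :=
    orbit_primitive (@perm_inj _ sigma) (D := out) (fun d => tail d == s1).
  by move=> d; rewrite sum_out_rotation; case: ifP.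
exists r; split=> // d td; have symf := fconnect_sym (@perm_inj _ sigma).
have tailE x : fconnect sigma (froot sigma d) x -> tail x = tail d.
  move=> rx; apply/eqP; rewrite -(fconnect_rotation rot_sigma).
  by apply: connect_trans (connect_root _ d) rx.
have r_step x : tail x = tail d -> r (sigma x) = r x.
  move=> tx; apply/esym/eqP/negbFE; rewrite -[~~ _]/(change sigma r x).
  by rewrite changeE out_special ?tx.
have : fconnect sigma (froot sigma d) d by rewrite symf connect_root.
apply: (connect_step_ind (P := fun x => r x = (tail d == s1))).
  by rewrite rootE /= ?tailE //; apply: roots_root symf d.
by move=> x y /tailE tx /eqP<- <-; apply: r_step.
Qed.

Lemma bichromatic_labeling_exists : exists lam,
  [/\ change sigma lam =1 out, special_labels lam & forall d, bichromatic phi lam d].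
Proof.
have [r [changeE special]] := special_rotation_primitive.
have injf := face_succ_inj (sigma := sigma) simple_e.
pose D := [set d | ~~ fconnect phi d d01 && ~~ fconnect phi d (rev_dart d01)].
have clD : fclosed phi D.
  by move=> x _ /eqP<-; rewrite !inE !(same_fconnect1 injf x).
have [|b [b_special bichrD]] := bichromatic_switching
    (R := rat) (t := @tail V e) injf (lam := r) (K := [set s0; s1]) _ clD.
  move=> S clS /subsetP subS S0; apply: boundary_kernel => //.
    by apply/negP => /subS; rewrite inE connect0.
  by apply/negP => /subS; rewrite inE connect0 andbF.
pose lam := switch (@tail V e) r b.
have lam_special : special_labels lam.
  move=> d; split=> td; rewrite /lam /switch special ?b_special ?td ?set21 ?set22 //.
    by rewrite (negbTE (tail_neq_head simple_e d01)).
  by rewrite eqxx.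
exists lam; split=> // d.
  by rewrite -changeE /change /lam /switch rot_sigma.1 !negb_eqb addbACA addbb addbF.
have [/bichrD //|] := boolP (d \in D).
have face_special x : same_edge x d01 -> fconnect phi d x -> bichromatic phi lam d.
  move=> x1 dx; apply: (bichromatic_neq dx (y := phi x)).
    by rewrite -same_fconnect1_r.
  by apply: special_labels_neq x1 _ _ => //; apply: tail_face_succ.
rewrite inE negb_and !negbK => /orP[]; apply: face_special.
  by rewrite /same_edge eqxx.
by rewrite /same_edge eqxx orbT.
Qed.

Section Labeling.
Variable lam : dart e -> bool.
Hypotheses (changeE : change sigma lam =1 out) (special : special_labels lam).

Lemma rotation_intervals d : tail d \notin [set s0; s1] ->
  one_interval_each (map lam (fingraph.orbit sigma d)).
Proof.
have injs := @perm_inj _ sigma.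
move=> td; apply: (one_ascent_intervals injs); apply/eqP.
rewrite -(eqn_pmul2l (m := 2)) // -(sum_changes injs lam (fconnect_fclosed injs d)).
by under eq_bigr do rewrite changeE; rewrite sum_out_rotation (negbTE td).
Qed.

Lemma edge_sides d : ~~ same_edge d d01 ->
  (lam d == lam (sigma d)) != (lam (rev_dart d) == lam (sigma (rev_dart d))).
Proof.
move=> d_special; have sides x : (lam x == lam (sigma x)) = ~~ out x.
  by rewrite -changeE negbK.
by rewrite !sides (inj_eq negb_inj) negb_eqb out_edge.
Qed.

Lemma face_changes d :
  change phi lam d + change phi lam (rev_dart d) = 1 + same_edge d d01.
Proof.
have neq x : same_edge x d01 -> change phi lam x.
  by move=> x1; apply: special_labels_neq x1 _ _ => //; apply: tail_face_succ.
have [d_special|/negbTE d_other] := boolP (same_edge d d01).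
  by rewrite !neq ?same_edge_rev.
have lam_sigma x : lam (sigma x) = lam x (+) out x.
  by rewrite -changeE /change negb_eqb addKb.
rewrite /change /face_succ rev_dartK // !lam_sigma.
move: (out_edge d); rewrite d_other.
by case: (lam d); case: (lam (rev_dart d)); case: (out d); case: (out (rev_dart d)).
Qed.

Lemma sum_face_changes : \sum_d change phi lam d = #|edges e| + 1.
Proof.
have [o oo od01] := orientation_through simple_e d01.
rewrite (sum_oriented_darts simple_e _ oo); under eq_bigr do rewrite face_changes.
rewrite big_split /= sum1dep_card card_oriented_darts //; congr (_ + _).
rewrite -[RHS]/(nat_of_bool true) -od01 -(sum_eq_indicator o).
apply: eq_bigr => d od; rewrite /same_edge (_ : d == rev_dart d01 = false) ?orbF //.
by apply: contraTF od => /eqP->; rewrite oo od01.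
Qed.

End Labeling.
End Embedding.
End Laman.

Theorem theorem38 (V : finType) (e : rel V) (sigma : {perm dart e}) :
  simple_graph e -> laman e -> plane_embedding sigma ->
  exists (s0 s1 : V) (lam : dart e -> bool), ext_weak_labeling sigma s0 s1 lam.
Proof.
move=> simple_e laman_e plane; have [rot_sigma [conn_e _]] := plane.
have /card_gt0P[d01 _] := laman_has_dart laman_e.
have [out [out_edge out_deg]] := laman_out_darts simple_e laman_e d01.
have [lam [changeE special bichr]] :=
  bichromatic_labeling_exists simple_e laman_e rot_sigma conn_e out_deg.
exists (tail d01), (head d01), lam; split; first by split=> //; apply: valP d01.
split=> [d /eqP/negbTE t0 /eqP/negbTE t1|].
  by apply: rotation_intervals out_deg _ changeE _ _; rewrite ?inE ?t0 ?t1.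
split=> [d|].
  by rewrite eq_endpoints //; apply: edge_sides out_edge _ changeE _.
apply: tight_changes_intervals bichr _; first exact: face_succ_inj.
by rewrite (sum_face_changes simple_e rot_sigma out_edge changeE special)
  (laman_face_count laman_e plane).
Qed.
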